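(* For all sufficiently small $\varepsilon>0$, $$\mathcal B\left(\left(\tfrac13,\tfrac23\right)+\varepsilon\left(\tfrac12,1\right)\right)<\mathcal B\left(\tfrac13,\tfrac23\right).$$
   Context: Let $\{x\}=x-\lfloor x\rfloor$, and for real $X,Y,Z$ let $\chi(X,Y,Z)=1$ if $\{X+\frac12\}+2\{Y\}<\{Z\}$ and $\chi(X,Y,Z)=0$ otherwise. For $p=(\alpha,\beta)$ with $\alpha,\beta>0$ and $\alpha+2\beta>1$ put $$\phi(p)=\int_0^\infty\chi(\alpha t,\beta t,t)\,\frac{dt}{t^2},$$ $$G(p)=2\alpha+4\beta-2-\left(5\beta-\tfrac52\right)\log 2,\qquad \mathcal C(p)=G(p)-\phi(p),$$ $$F_p(y)=\alpha\log|y|+\beta\log|y^2+6y+25|-\log|25-y|,$$ $$P(y;p)=(\alpha+2\beta-1)y^3-(19\alpha+44\beta+6)y^2-(125\alpha+150\beta+25)y-625\alpha .$$ The cubic $P(\cdot\,;p)$ has exactly one positive real root $y_+(p)$, and $y_+(p)>25$. When $P(\cdot\,;p)$ has a root in the open upper half-plane, call it $y_c(p)$ (it is then unique), and set $$r(p)=F_p(y_+(p)),\qquad s(p)=F_p(y_c(p)).$$ Where $y_c(p)$ exists and $-s(p)-\mathcal C(p)>0$, define $$\mathcal B(p)=1+\frac{r(p)+\mathcal C(p)}{-s(p)-\mathcal C(p)} .$$ Both conditions hold at $(\frac13,\frac23)$ and at the perturbed points for small $\varepsilon>0$. *)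

(* Defs.v *)
From HB Require Import structures.
From mathcomp Require Import all_boot all_order all_algebra.
From mathcomp Require Import all_classical all_reals all_analysis.
From mathcomp Require Import complex.
Set Implicit Arguments.
Unset Strict Implicit.
Unset Printing Implicit Defensive.
Import Order.TTheory GRing.Theory Num.Theory.
Import numFieldNormedType.Exports.
Import ComplexField.Normc.
Local Open Scope classical_set_scope.
Local Open Scope complex_scope.
Local Open Scope ring_scope.

Definition frac (R : realType) (x : R) : R := x - (Num.floor x)%:~R.

Definition chi (R : realType) (X Y Z : R) : R :=
  if frac (X + 1 / 2) + 2 * frac Y < frac Z then 1 else 0.

(* A parameter is a pair p = (alpha, beta). *)
Definition admissible (R : realType) (p : R * R) : Prop :=
  [/\ 0 < p.1, 0 < p.2 & 1 < p.1 + 2 * p.2].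

(* On admissible parameters chi (alpha t) (beta t) t = 0 for t near 0, so the
   integrand is integrable and this Lebesgue integral is the improper one. *)
Definition phi (R : realType) (p : R * R) : R :=
  \int[lebesgue_measure]_(t in `]0, +oo[) (chi (p.1 * t) (p.2 * t) t / t ^+ 2).

Definition G (R : realType) (p : R * R) : R :=
  2 * p.1 + 4 * p.2 - 2 - (5 * p.2 - 5 / 2) * ln 2.

Definition calC (R : realType) (p : R * R) : R := G p - phi p.

(* normc is the complex modulus with values in R, whereas `|z| has values in
   R[i]. *)
Definition F (R : realType) (p : R * R) (y : R[i]) : R :=
  p.1 * ln (normc y) + p.2 * ln (normc (y ^+ 2 + 6 * y + 25))
  - ln (normc (25 - y)).

Definition cubic (R : realType) (p : R * R) : {poly R} :=
  (p.1 + 2 * p.2 - 1) *: 'X^3 - (19 * p.1 + 44 * p.2 + 6) *: 'X^2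
  - (125 * p.1 + 150 * p.2 + 25) *: 'X - (625 * p.1)%:P.

(* xget picks an element of the set, with an arbitrary default when the set is
   empty; here the set is a singleton on admissible parameters. *)
Definition y_plus (R : realType) (p : R * R) : R :=
  xget 0 [set y : R | 0 < y /\ root (cubic p) y].

Definition upper_roots (R : realType) (p : R * R) : set R[i] :=
  [set z : R[i] | 0 < complex.Im z /\
                  root (map_poly (real_complex R) (cubic p)) z].

(* Meaningful when upper_roots p is nonempty; it is then a singleton. *)
Definition y_c (R : realType) (p : R * R) : R[i] := xget 0 (upper_roots p).

Definition r (R : realType) (p : R * R) : R := F p (y_plus p)%:C.

Definition s (R : realType) (p : R * R) : R := F p (y_c p).

Definition calB_defined (R : realType) (p : R * R) : Prop :=
  [/\ admissible p, upper_roots p !=set0 & 0 < - s p - calC p].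

(* Meaningful only when calB_defined p holds. *)
Definition calB (R : realType) (p : R * R) : R :=
  1 + (r p + calC p) / (- s p - calC p).

(* Main.v *)
Require Import Defs.
From mathcomp Require Import all_boot all_order all_algebra.
From mathcomp Require Import all_classical all_reals all_analysis.
From mathcomp Require Import measurable_realfun complex ring lra.
Set Implicit Arguments.
Unset Strict Implicit.
Unset Printing Implicit Defensive.
Import Order.TTheory GRing.Theory Num.Theory.
Import numFieldNormedType.Exports.
Local Open Scope classical_set_scope.
Local Open Scope ring_scope.

(** The direction (1/2, 1) is parallel to the base point (1/3, 2/3), so the
    perturbed points are the dilates lam (1/3, 2/3) with lam = 1 + h, h > 0.
    The theorem holds because C has slope minus infinity at lam = 1 from the
    right, while r and s vary at most linearly in h.

    At lam = 1 the function chi has period 3 in t and is the indicator of the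
    windows [3k + 3/2, 3k + 2[.  For lam = 1 + h each window with h t small
    gains the interval from (3k + 3/2) / lam to 3k + 3/2, which contributes
    h / (3k + 3/2) to phi.  This works for all k up to a multiple of 1 / h, and
    everything beyond contributes O(h).  The gains add up to a harmonic sum
    times h, of order h log (1 / h), so phi increases faster than any linear
    function ([phi_dilate_steep]).

    The positive root of the cubic is Lipschitz in h because the cubic has
    slope bounded below near it ([y_plus_lip]).  After division by this root,
    y_c is a root of a quadratic y^2 + m y + n whose coefficients are explicit
    in h and in the positive root, and F (y_c) depends on y_c only through
    logarithms of polynomials in m and n ([F_complex]).  Hence r and s are
    Lipschitz at 0 ([r_lip0], [s_lip0]).

    Since r > s at the base point, a drop of C that dominates the increments of
    r and s makes the ratio in B smaller ([ratio_lt]).  The base point itself is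
    in the domain of B because s < - G there ([s_base_lt]) and phi >= 0. *)

(** * Integrals of step functions against dt / t^2 *)

Definition tail_density (R : realType) (a t : R) : R := (a <= t)%R%:R / t ^+ 2.

Lemma measurable_inv_sqr (R : realType) :
  measurable_fun (`]0, +oo[ : set R) (fun t : R => (t ^+ 2)^-1).
Proof.
apply: open_continuous_measurable_fun; first exact: interval_open.
move=> t; rewrite inE /= in_itv /= andbT => t0.
apply: (@continuous_comp _ _ _ (fun t : R => t ^+ 2) GRing.inv).
  exact: exprn_continuous.
by apply: inv_continuous; rewrite expf_neq0// gt_eqF.
Qed.

Lemma integral_inv_sqr (R : realType) (a : R) : 0 < a ->
  (\int[lebesgue_measure]_(t in `[a, +oo[) ((t ^+ 2)^-1)%:E = (a^-1)%:E)%E.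
Proof.
move=> a0.
rewrite (@ge0_continuous_FTC2y R _ (fun t => - t^-1) a 0).
- by rewrite -EFinB opprK add0r.
- by move=> t _; rewrite invr_ge0 exprn_even_ge0.
- apply: continuous_in_subspaceT => t; rewrite inE /= in_itv /= andbT => t0.
  apply: (@continuous_comp _ _ _ (fun t : R => t ^+ 2) GRing.inv).
    exact: exprn_continuous.
  by apply: inv_continuous; rewrite expf_neq0// gt_eqF// (lt_le_trans a0).
- rewrite -oppr0; apply: cvgN; apply/gtr0_cvgV0; last exact: cvg_id.
  by near=> t; near: t; exact: nbhs_pinfty_gt.
- move=> t a_t; apply: derivableN; apply: derivableV => //.
  by rewrite gt_eqF// (lt_trans a0).
- apply: cvgN; apply: cvg_at_right_filter.
  by apply: inv_continuous; rewrite gt_eqF.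
- move=> t; rewrite in_itv /= andbT => a_t.
  have t0 : t != 0 by rewrite gt_eqF// (lt_trans a0).
  rewrite derive1E deriveN; last exact: derivableV.
  rewrite deriveV// derive_id scaleNr opprK.
  by rewrite /GRing.scale /= mulr1.
Unshelve. all: end_near. Qed.

Lemma measurable_weight (R : realType) (g : R -> R) :
  measurable_fun setT g ->
  measurable_fun (`]0, +oo[ : set R) (fun t => g t / t ^+ 2).
Proof.
move=> mg; apply: measurable_funM; last exact: measurable_inv_sqr.
exact: measurable_funTS.
Qed.

Lemma integral_tail (R : realType) (a : R) : 0 < a ->
  (\int[lebesgue_measure]_(t in `]0%R, +oo[) (tail_density a t)%:E =
   (a^-1)%:E)%E.
Proof.
move=> a0; rewrite -integral_inv_sqr//.
have -> : `[a, +oo[%classic = `]0, +oo[%classic `&` `[a, +oo[%classic.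
  apply/seteqP; split => t /=; rewrite !in_itv /= !andbT; last by case.
  by move=> a_t; split => //; exact: lt_le_trans a_t.
rewrite integral_mkcondr; apply: eq_integral => t _.
rewrite /tail_density patchE mem_setE in_itv /= andbT.
by case: ifP; rewrite ?mul1r ?mul0r.
Qed.

Lemma measurable_tail (R : realType) (a : R) :
  measurable_fun (`]0, +oo[ : set R) (tail_density a).
Proof.
apply: measurable_weight.
rewrite (_ : (fun _ => _) = (fun t => if a <= t then 1 else 0)).
  apply: measurable_fun_ifT => //; exact: measurable_fun_ler.
by apply/funext => t; case: (a <= t).
Qed.

Lemma integrable_tail (R : realType) (a : R) : 0 < a ->
  lebesgue_measure.-integrable (`]0, +oo[ : set R) (EFin \o tail_density a).
Proof.
move=> a0; apply/integrableP; split.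
  by apply/measurable_EFinP; exact: measurable_tail.
apply: (@le_lt_trans _ _ (a^-1)%:E); last exact: ltry.
rewrite -integral_tail// le_eqVlt; apply/orP; left; apply/eqP.
apply: eq_integral => t _ /=; rewrite ger0_norm// /tail_density.
by rewrite divr_ge0// ?ler0n// exprn_even_ge0.
Qed.

(** A step function is used through its jumps: the indicator of [a, b[ is the
    difference of two tails, so its integral against dt / t^2 is 1/a - 1/b. *)
Definition steps (R : realType) (N : nat) (a b : nat -> R) (t : R) : R :=
  \sum_(k < N) (tail_density (a k) t - tail_density (b k) t).

Lemma integrable_steps (R : realType) N (a b : nat -> R) :
  (forall k, 0 < a k) -> (forall k, 0 < b k) ->
  lebesgue_measure.-integrable (`]0, +oo[ : set R) (EFin \o steps N a b).
Proof.
move=> a0 b0; rewrite (_ : _ \o _ =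
    fun t => (\sum_(k < N) ((EFin \o tail_density (a k)) \-
                            (EFin \o tail_density (b k))) t)%E).
  apply: integrable_sum => // k _.
  by apply: integrableB => //; exact: integrable_tail.
by apply/funext => t /=; rewrite sumEFin.
Qed.

Lemma Rintegral_steps (R : realType) N (a b : nat -> R) :
  (forall k, 0 < a k) -> (forall k, 0 < b k) ->
  \int[lebesgue_measure]_(t in `]0, +oo[) steps N a b t =
  \sum_(k < N) ((a k)^-1 - (b k)^-1).
Proof.
move=> a0 b0; rewrite /Rintegral.
have -> : (\int[lebesgue_measure]_(t in `]0%R, +oo[) (steps N a b t)%:E =
    \int[lebesgue_measure]_(t in `]0%R, +oo[)
      (\sum_(k < N) ((EFin \o tail_density (a k)) \-
                     (EFin \o tail_density (b k))) t))%E.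
  by apply: eq_integral => t _ /=; rewrite sumEFin.
rewrite integral_sum//; last first.
  by move=> k; apply: integrableB => //; exact: integrable_tail.
rewrite (eq_bigr (fun k : 'I_N => ((a k)^-1 - (b k)^-1)%:E)).
  by rewrite sumEFin.
move=> k _; rewrite integralB//; try exact: integrable_tail.
by rewrite !integral_tail.
Qed.

(** * The integral phi along the ray through the base point *)

Definition dilate (R : realType) (lam : R) : R * R := (lam / 3, 2 * lam / 3).

Lemma fracE (R : realType) (x d : R) (n : nat) :
  x = n%:R + d -> 0 <= d < 1 -> Defs.frac x = d.
Proof.
move=> -> /andP[d0 d1]; rewrite /Defs.frac (@floor_def _ _ n%:Z).
  by rewrite addrAC subrr add0r.
by rewrite intrD -!pmulrn lerDl d0 ltrD2l.
Qed.

Lemma frac_ge0 (R : realType) (x : R) : 0 <= Defs.frac x.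
Proof. by rewrite subr_ge0 floor_le_tmp. Qed.

Lemma frac_le (R : realType) (x : R) (n : nat) :
  n%:R <= x -> Defs.frac x <= x - n%:R.
Proof. by move=> nx; rewrite lerD2l lerN2 pmulrn ler_int floor_ge_int. Qed.

(** With w = t - 3k - 1 the two sides compared by chi are
    5 (w - 1/2 + (lam - 1) t) / 3 and w; the phase (lam - 1) t is at most 1/10,
    which leaves the comparison true for all w < 1. *)
Lemma chi_window (R : realType) (lam t : R) (k : nat) :
  1 <= lam -> (lam - 1) * (3 * k%:R + 3) <= 1 / 10 ->
  (3 * k%:R + 3 / 2) / lam <= t < 3 * k%:R + 2 ->
  chi (lam / 3 * t) (2 * lam / 3 * t) t = 1.
Proof.
move=> lam1 lamk /andP[]; rewrite ler_pdivrMr; last by lra.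
move=> kt tk; have k0 : 0 <= k%:R :> R by rewrite ler0n.
have t0 : 0 <= t.
  case: (leP 0 t) => // t0.
  have : t * (lam - 1) <= 0 by rewrite mulr_le0_ge0//; lra.
  by lra.
have h0 : 0 <= (lam - 1) * t by rewrite mulr_ge0//; lra.
have h1 : (lam - 1) * t <= 1 / 10.
  by apply: le_trans lamk; apply: ler_wpM2l; lra.
have E : t * lam = t + (lam - 1) * t by ring.
rewrite /chi.
rewrite (@fracE _ _ ((t * lam - 3 * k%:R - 3 / 2) / 3) k.+1); first last.
- by apply/andP; split; lra.
- by rewrite -(@natr1 R k); lra.
rewrite (@fracE _ (2 * lam / 3 * t)
  (2 * (t * lam - 3 * k%:R - 3 / 2) / 3) (2 * k).+1); first last.
- by apply/andP; split; lra.
- by rewrite -(@natr1 R (2 * k)) natrM; lra.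
rewrite (@fracE _ t (t - 3 * k%:R - 1) (3 * k).+1); first last.
- by apply/andP; split; lra.
- by rewrite -(@natr1 R (3 * k)) natrM; lra.
by rewrite ifT//; lra.
Qed.

(** With u = t - 3k in [0, 3[, the left-hand side is 5u/3 + 1/2 before u = 3/2,
    which exceeds u, and 5 (u - 3/2) / 3 afterwards, which exceeds {t} = u - 2
    once u >= 2. *)
Lemma chi_base_support (R : realType) (t : R) (k : nat) :
  3 * k%:R <= t < 3 * k%:R + 3 ->
  ~~ (3 * k%:R + 3 / 2 <= t < 3 * k%:R + 2) ->
  chi (1 / 3 * t) (2 * 1 / 3 * t) t = 0.
Proof.
move=> /andP[kt tk] out; rewrite /chi ifF//; apply/negbTE; rewrite -leNgt.
case: (ltP t (3 * k%:R + 3 / 2)) => t1.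
  rewrite (@fracE _ (1 / 3 * t + 1 / 2)
    ((t - 3 * k%:R) / 3 + 1 / 2) k); first last.
  - by apply/andP; split; lra.
  - by lra.
  rewrite (@fracE _ (2 * 1 / 3 * t) (2 * (t - 3 * k%:R) / 3) (2 * k));
    first last.
  - by apply/andP; split; lra.
  - by rewrite natrM; lra.
  have /frac_le : (3 * k)%:R <= t by rewrite natrM.
  by rewrite natrM; lra.
move: out; rewrite t1 /= -leNgt => t2.
rewrite (@fracE _ (1 / 3 * t + 1 / 2)
    ((t - 3 * k%:R) / 3 - 1 / 2) k.+1); first last.
- by apply/andP; split; lra.
- by rewrite -(@natr1 R k); lra.
rewrite (@fracE _ (2 * 1 / 3 * t) (2 * (t - 3 * k%:R) / 3 - 1) (2 * k).+1);
  first last.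
- by apply/andP; split; lra.
- by rewrite -(@natr1 R (2 * k)) natrM; lra.
have /frac_le : (3 * k).+2%:R <= t.
  by rewrite -(@natr1 R (3 * k).+1) -(@natr1 R (3 * k)) natrM; lra.
by rewrite -(@natr1 R (3 * k).+1) -(@natr1 R (3 * k)) natrM; lra.
Qed.

(** The first fractional part alone is at least 1/2, and {t} = t < 1/2. *)
Lemma chi_early (R : realType) (lam t : R) :
  0 <= lam <= 3 -> 0 < t < 1 / 2 -> chi (lam / 3 * t) (2 * lam / 3 * t) t = 0.
Proof.
move=> /andP[lam0 lam3] /andP[t0 t1].
have h0 : 0 <= lam * t by rewrite mulr_ge0// ltW.
have h1 : lam * t <= 3 * t by rewrite ler_wpM2r// ltW.
rewrite /chi ifF//; apply/negbTE; rewrite -leNgt.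
rewrite (@fracE _ (lam / 3 * t + 1 / 2) (lam * t / 3 + 1 / 2) 0); first last.
- by apply/andP; split; lra.
- by lra.
have := frac_ge0 (2 * lam / 3 * t).
have /frac_le : 0%:R <= t by exact: ltW.
by lra.
Qed.

Lemma chi_le1 (R : realType) (X Y Z : R) : chi X Y Z <= 1.
Proof. by rewrite /chi; case: ifP. Qed.

Lemma chi_ge0 (R : realType) (X Y Z : R) : 0 <= chi X Y Z.
Proof. by rewrite /chi; case: ifP. Qed.

Lemma measurable_frac (R : realType) : measurable_fun setT (@Defs.frac R).
Proof.
apply: measurable_funB => //; apply: nondecreasing_measurable => //.
by move=> x y xy; rewrite ler_int; exact: le_floor.
Qed.

Lemma measurable_chi (R : realType) (a b : R) :
  measurable_fun setT (fun t => chi (a * t) (b * t) t).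
Proof.
have mfrac (f : R -> R) :
    measurable_fun setT f -> measurable_fun setT (fun t => Defs.frac (f t)).
  by move=> mf; exact: measurableT_comp (@measurable_frac R) mf.
apply: measurable_fun_ifT => //; apply: measurable_fun_ltr; last first.
  exact: measurable_frac.
apply: measurable_funD.
  by apply: mfrac; apply: measurable_funD => //; exact: measurable_funM.
apply: measurable_funM => //; apply: mfrac; exact: measurable_funM.
Qed.

Lemma integrable_chi (R : realType) (lam : R) : 0 <= lam <= 3 ->
  lebesgue_measure.-integrable (`]0, +oo[ : set R)
    (EFin \o (fun t => chi (lam / 3 * t) (2 * lam / 3 * t) t / t ^+ 2)).
Proof.
move=> lamb; apply: le_integrable (@integrable_tail R (1 / 2) _) => //.
  apply/measurable_EFinP; apply: measurable_weight; exact: measurable_chi.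
move=> t /=; rewrite in_itv /= andbT => t0.
rewrite lee_fin !ger0_norm ?divr_ge0 ?ler0n ?chi_ge0 ?exprn_even_ge0//.
rewrite /tail_density ler_pM2r ?invr_gt0 ?exprn_gt0//.
case: (leP (1 / 2) t) => t1; first exact: chi_le1.
by rewrite chi_early// t0.
Qed.

Lemma phi_ge0 (R : realType) (p : R * R) : 0 <= phi p.
Proof.
apply: Rintegral_ge0 => t _.
by rewrite divr_ge0 ?chi_ge0 ?exprn_even_ge0.
Qed.

Lemma steps_indic (R : realType) N (a b : nat -> R) t :
  (forall k, a k <= b k) ->
  steps N a b t = (\sum_(k < N) (a k <= t < b k)%R%:R) / t ^+ 2.
Proof.
move=> ab; rewrite mulr_suml; apply: eq_bigr => k _.
rewrite /tail_density -mulrBl.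
congr (_ * _); case: (ltP t (b k)) => tb; rewrite ?andbT ?andbF ?subr0//.
by rewrite (le_trans (ab k) tb) subrr.
Qed.

(** Window k lies in [3k, 3k + 3[, so a point meets at most one of them. *)
Lemma windows_le1 (R : realType) N (a b : nat -> R) (t : R) :
  (forall k : 'I_N, 3 * k%:R <= a k) ->
  (forall k : 'I_N, b k <= 3 * k%:R + 3) ->
  \sum_(k < N) (a k <= t < b k)%R%:R <= 1 :> R.
Proof.
move=> ak bk; apply: (@le_trans _ _
    (\sum_(k < N) (k == Num.truncn (t / 3) :> nat)%:R)).
  apply: ler_sum => k _; case: (boolP (a k <= t < b k)) => [/andP[akt tbk]|_].
    rewrite (@truncn_def _ (t / 3) k) ?eqxx// -(@natr1 R k).
    have := ak k; have := bk k; move: akt tbk.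
    by set A := a k; set B := b k; move=> *; apply/andP; split; lra.
  by rewrite ler0n.
case: (ltnP (Num.truncn (t / 3)) N) => [lt_N|ge_N].
  rewrite (bigD1 (Ordinal lt_N))//= eqxx big1 ?addr0// => k.
  by rewrite -val_eqE /= => /negbTE ->.
rewrite big1 ?ler01// => k _; case: eqP => // E.
by move: (ltn_ord k); rewrite E ltnNge ge_N.
Qed.

(** As lam grows past 1, the left end of the window [3k + 3/2, 3k + 2[ moves to
    (3k + 3/2) / lam, while the right end, where the fractional part of t jumps,
    stays in place. *)
Lemma phi_dilate_ge (R : realType) (lam : R) (N : nat) :
  1 <= lam <= 2 -> (lam - 1) * (3 * N%:R) <= 1 / 10 ->
  \sum_(k < N) (((3 * k%:R + 3 / 2) / lam)^-1 - (3 * k%:R + 2)^-1)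
    <= phi (dilate lam).
Proof.
move=> /andP[lam1 lam2] lamN.
have lam0 : 0 < lam by lra.
have k0 (k : nat) : 0 <= k%:R :> R by rewrite ler0n.
pose a (k : nat) : R := (3 * k%:R + 3 / 2) / lam.
pose b (k : nat) : R := 3 * k%:R + 2.
have a0 k : 0 < a k by rewrite divr_gt0//; have := k0 k; lra.
have b0 k : 0 < b k by rewrite /b; have := k0 k; lra.
rewrite -(Rintegral_steps N a0 b0).
apply: le_Rintegral => //; first exact: integrable_steps.
  by apply: integrable_chi; lra.
move=> t /=; rewrite in_itv /= andbT => t0.
have ab k : a k <= b k.
  rewrite ler_pdivrMr// /b; have := k0 k.
  have : (3 * k%:R + 2) * 1 <= (3 * k%:R + 2) * lam :> R.
    by rewrite ler_wpM2l//; have := k0 k; lra.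
  by lra.
rewrite steps_indic// ler_pM2r ?invr_gt0 ?exprn_gt0//.
have [/existsP[k kt]|] := boolP [exists k : 'I_N, a k <= t < b k].
  have lamk (j : nat) : (j < N)%N -> (lam - 1) * (3 * j%:R + 3) <= 1 / 10.
    move=> jN; apply: le_trans lamN; apply: ler_wpM2l; first by lra.
    have : j.+1%:R <= N%:R :> R by rewrite ler_nat.
    by rewrite -(@natr1 R j); lra.
  rewrite (@chi_window _ _ _ k)//; last exact: lamk.
  apply: windows_le1 => j; last by rewrite /b; lra.
  rewrite ler_pdivlMr//.
  by have := lamk j (ltn_ord j); have := k0 j; lra.
rewrite negb_exists => /forallP none; rewrite big1 ?chi_ge0// => k _.
by rewrite (negbTE (none k)).
Qed.

Lemma Rintegral_tail (R : realType) (a : R) : 0 < a ->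
  \int[lebesgue_measure]_(t in `]0, +oo[) tail_density a t = a^-1.
Proof. by move=> a0; rewrite /Rintegral integral_tail. Qed.

(** On the whole tail [3N, +oo[ chi is bounded by 1, which costs 1 / (3N). *)
Lemma phi_base_le (R : realType) (N : nat) : (0 < N)%N ->
  phi (dilate (1 : R)) <=
  \sum_(k < N) ((3 * k%:R + 3 / 2)^-1 - (3 * k%:R + 2)^-1) + (3 * N%:R)^-1.
Proof.
move=> N0.
have k0 (k : nat) : 0 <= k%:R :> R by rewrite ler0n.
pose a (k : nat) : R := 3 * k%:R + 3 / 2.
pose b (k : nat) : R := 3 * k%:R + 2.
have a0 k : 0 < a k by rewrite /a; have := k0 k; lra.
have b0 k : 0 < b k by rewrite /b; have := k0 k; lra.
have N30 : 0 < 3 * N%:R :> R by rewrite mulr_gt0// ltr0n.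
have iN := integrable_tail N30.
have isteps := integrable_steps N a0 b0.
rewrite -(Rintegral_steps N a0 b0) -(Rintegral_tail N30) -RintegralD//.
apply: le_Rintegral => //; first by apply: integrable_chi; lra.
  rewrite (_ : _ \o _ =
      (EFin \o steps N a b) \+ (EFin \o tail_density (3 * N%:R)))%E//.
  exact: integrableD.
move=> t /=; rewrite in_itv /= andbT => t0.
rewrite steps_indic; last by move=> k; rewrite /a /b; lra.
rewrite /tail_density -mulrDl ler_pM2r ?invr_gt0 ?exprn_gt0//.
have S0 : 0 <= \sum_(k < N) (a k <= t < b k)%R%:R :> R.
  by apply: sumr_ge0 => k _; rewrite ler0n.
case: (leP (3 * N%:R) t) => [_|tN].
  by apply: le_trans (chi_le1 _ _ _) _; rewrite mulr1n; lra.
rewrite addr0; set k := Num.truncn (t / 3).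
have /andP[kt tk] : k%:R <= t / 3 < k.+1%:R by apply: truncn_itv; lra.
rewrite -(@natr1 R k) in tk.
have kN : (k < N)%N by rewrite -(ltr_nat R); lra.
case: (boolP (a k <= t < b k)) => [w|w]; last first.
  by rewrite (@chi_base_support _ _ k)//; apply/andP; split; lra.
apply: le_trans (chi_le1 _ _ _) _.
rewrite (bigD1 (Ordinal kN))//= w lerDl.
by apply: sumr_ge0 => j _; rewrite ler0n.
Qed.

(** The window k gains h / (3k + 3/2) in phi, and the windows below a multiple
    of 1 / h all count.  Their gains add up to h times a divergent harmonic sum,
    and the tail beyond them is only O(h). *)
Lemma phi_dilate_steep (R : realType) (K : R) :
  exists2 h0 : R, 0 < h0 & forall h, 0 < h < h0 ->
    K * h <= phi (dilate (1 + h)) - phi (dilate 1).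
Proof.
have : series (@harmonic R) @ \oo --> +oo.
  apply: nondecreasing_dvgn_lt; last exact: dvg_harmonic.
  by apply: nondecreasing_series => k _ _; exact: harmonic_ge0.
move=> /cvgryPge /(_ (3 * (K + 20))) [N0 _ big_harm].
have N01 : 0 < N0.+1%:R :> R by rewrite ltr0n.
exists ((30 * N0.+1%:R)^-1); first by rewrite invr_gt0 mulr_gt0.
move=> h /andP[h_gt0 hh0].
have hN0 : h * (30 * N0.+1%:R) < 1 by rewrite -ltr_pdivlMr ?div1r// mulr_gt0.
(* The largest number of windows on which the phase 3 N h is at most 1/10. *)
set N := Num.truncn (1 / (30 * h)).
have h30 : 0 < 30 * h by lra.
have /andP[] : N%:R <= 1 / (30 * h) < N.+1%:R.
  by apply: truncn_itv; rewrite divr_ge0// ltW.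
rewrite ler_pdivlMr// ltr_pdivrMr// => Nh hN.
have N0N : (N0 < N)%N.
  rewrite -ltnS -(ltr_nat R) -(ltr_pM2r h30).
  by apply: lt_trans hN; lra.
have N_gt0 : (0 < N)%N by exact: leq_ltn_trans N0N.
have N1 : 1 <= N%:R :> R by rewrite ler1n.
have h1 : h <= 1 by have : 1 <= N0.+1%:R :> R by [rewrite ler1n]; nra.
have ge := @phi_dilate_ge R (1 + h) N.
have le := @phi_base_le R N N_gt0.
have {}ge := ge ltac:(lra) ltac:(lra).
have tail : (3 * N%:R)^-1 <= 20 * h.
  rewrite invf_ple ?posrE; [|nra|nra].
  rewrite -div1r ler_pdivrMr; last by lra.
  by rewrite -(@natr1 R N) in hN; nra.
have gain : h * (K + 20) <= \sum_(k < N)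
    ((((3 * k%:R + 3 / 2) / (1 + h))^-1 - (3 * k%:R + 2)^-1) -
     ((3 * k%:R + 3 / 2)^-1 - (3 * k%:R + 2)^-1)).
  apply: (@le_trans _ _ (\sum_(k < N) h * (harmonic k / 3))).
    rewrite -mulr_sumr -mulr_suml ler_pM2l// ler_pdivlMr// mulrC.
    by have := big_harm N (ltnW N0N); rewrite /= /series /= big_mkord.
  apply: ler_sum => k _.
  have k0 : 0 <= k%:R :> R by rewrite ler0n.
  have -> : forall x y z : R, x - y - (z - y) = x - z by move=> *; ring.
  rewrite invf_div mulrDl mul1r addrAC subrr add0r ler_pM2l//.
  rewrite /harmonic /= -invfM lef_pV2 ?posrE -?(@natr1 R k); lra.
move: gain; rewrite sumrB; lra.
Qed.

(** * The roots of the cubic along the ray *)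

(** Kept over any ring, to be evaluated at real and at complex points. *)
Definition cubic_val (R : pzRingType) (a b c d y : R) : R :=
  a * y ^+ 3 - b * y ^+ 2 - c * y - d.

Definition coef_a (R : realType) (lam : R) := 5 / 3 * lam - 1.
Definition coef_b (R : realType) (lam : R) := 107 / 3 * lam + 6.
Definition coef_c (R : realType) (lam : R) := 425 / 3 * lam + 25.
Definition coef_d (R : realType) (lam : R) := 625 / 3 * lam.

Lemma cubic_dilate (R : realType) (lam : R) :
  cubic (dilate lam) = coef_a lam *: 'X^3 - coef_b lam *: 'X^2
                       - coef_c lam *: 'X - (coef_d lam)%:P.
Proof.
rewrite /cubic /dilate /= /coef_a /coef_b /coef_c /coef_d.
by congr (_ *: _ - _ *: _ - _ *: _ - _%:P); lra.
Qed.

Lemma horner_cubic (R : realType) (lam y : R) :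
  (cubic (dilate lam)).[y] =
  cubic_val (coef_a lam) (coef_b lam) (coef_c lam) (coef_d lam) y.
Proof. by rewrite cubic_dilate /cubic_val !hornerE. Qed.

Lemma horner_cubicC (R : realType) (lam : R) (z : R[i]) :
  (map_poly (real_complex R) (cubic (dilate lam))).[z] =
  cubic_val (real_complex R (coef_a lam)) (real_complex R (coef_b lam))
    (real_complex R (coef_c lam)) (real_complex R (coef_d lam)) z.
Proof.
rewrite cubic_dilate.
move: (coef_a _) (coef_b _) (coef_c _) (coef_d _) => a b c d.
rewrite !rmorphB /= !map_polyZ /= !map_polyXn map_polyX map_polyC /cubic_val.
by rewrite !(hornerD, hornerN, hornerZ, hornerXn, hornerX, hornerC).
Qed.

(** For y <= 60 the leading term is dominated by the quadratic one, and for
    y = 67 + w the cubic has nonnegative coefficients in w. *)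
Lemma positive_root_bounds (R : realType) (h y : R) :
  0 <= h <= 1 / 100 -> 0 < y -> root (cubic (dilate (1 + h))) y -> 60 < y < 67.
Proof.
move=> /andP[h0 h1] y0; rewrite rootE horner_cubic /cubic_val => /eqP.
rewrite /coef_a /coef_b /coef_c /coef_d => E.
apply/andP; split; rewrite ltNge; apply/negP => yy.
  have y2 : 0 < y ^+ 2 by rewrite exprn_gt0.
  have : y ^+ 2 * ((5 / 3 * (1 + h) - 1) * y - (107 / 3 * (1 + h) + 6)) <= 0.
    by rewrite mulr_ge0_le0// ?ltW//; nra.
  have : 0 <= h * y by rewrite mulr_ge0// ltW.
  by rewrite !exprS in E *; lra.
pose w := y - 67; have yE : y = 67 + w by rewrite /w; lra.
have w0 : 0 <= w by rewrite /w; lra.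
have w2 : 0 <= w ^+ 2 by rewrite exprn_ge0.
have w3 : 0 <= w ^+ 3 by rewrite exprn_ge0.
have hw : 0 <= h * w by rewrite mulr_ge0.
have hw2 : 0 <= h * w ^+ 2 by rewrite mulr_ge0.
have hw3 : 0 <= h * w ^+ 3 by rewrite mulr_ge0.
by move: E; rewrite yE; lra.
Qed.

Lemma root_in (R : realType) (h u v : R) :
  u <= v -> (cubic (dilate (1 + h))).[u] <= 0 <= (cubic (dilate (1 + h))).[v] ->
  exists2 y, u <= y <= v & root (cubic (dilate (1 + h))) y.
Proof. by move=> uv; exact: poly_ivt. Qed.

Lemma y_plusP (R : realType) (h : R) : 0 <= h <= 1 / 100 ->
  60 < y_plus (dilate (1 + h)) < 67 /\
  root (cubic (dilate (1 + h))) (y_plus (dilate (1 + h))).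
Proof.
move=> hb; have /andP[h0 h1] := hb.
have [|y /andP[y1 y2] ry] := @root_in R h 60 67 ltac:(lra).
  rewrite !horner_cubic /cubic_val /coef_a /coef_b /coef_c /coef_d.
  by apply/andP; split; lra.
have y0 : 0 < y by lra.
have [p0 rp] := xgetI 0 (conj y0 ry :
  [set y : R | 0 < y /\ root (cubic (dilate (1 + h))) y] y).
by split => //; exact: positive_root_bounds rp.
Qed.

Lemma y_plus_base (R : realType) : 66 < y_plus (dilate (1 + 0 : R)) < 133 / 2.
Proof.
have [b0 r0] : _ := @y_plusP R 0 ltac:(lra).
move: b0 r0; set y := y_plus _ => /andP[y1 y2].
rewrite rootE horner_cubic /cubic_val /coef_a /coef_b /coef_c /coef_d => /eqP E.
apply/andP; split; rewrite ltNge; apply/negP => yy; first by nra.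
by nra.
Qed.

(** Subtracting the two root equations gives (y - x) slope = - h shift, where
    slope is the divided difference of the base cubic, at least 2000 on
    [60, 67], and shift is the derivative of the cubic in h. *)
Lemma y_plus_lip (R : realType) (h : R) : 0 <= h <= 1 / 100 ->
  `|y_plus (dilate (1 + h)) - y_plus (dilate (1 + 0))| <= 400 * h.
Proof.
move=> hb; have [] := @y_plusP R h hb; have [] := @y_plusP R 0 ltac:(lra).
have /andP[h0 h1] := hb.
set x := y_plus (dilate (1 + 0)); set y := y_plus _.
move=> /andP[x1 x2]; rewrite rootE horner_cubic => /eqP Ex.
move=> /andP[y1 y2]; rewrite rootE horner_cubic => /eqP Ey.
pose slope := 2 / 3 * (y ^+ 2 + y * x + x ^+ 2) - 125 / 3 * (y + x) - 500 / 3.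
pose shift := 5 / 3 * y ^+ 3 - 107 / 3 * y ^+ 2 - 425 / 3 * y - 625 / 3.
have E : (y - x) * slope = - (h * shift).
  move: Ex Ey; rewrite /cubic_val /coef_a /coef_b /coef_c /coef_d.
  by rewrite /slope /shift; lra.
have slope_ge : 2000 <= slope by rewrite /slope; nra.
have shift_b : `|shift| <= 400 * 2000.
  have y2b : 3600 <= y ^+ 2 <= 67 ^+ 2 by apply/andP; split; nra.
  rewrite ler_norml /shift; have -> : y ^+ 3 = y * y ^+ 2 by rewrite exprS.
  by apply/andP; split; nra.
have : `|y - x| * slope = h * `|shift|.
  have s0 : 0 <= slope by lra.
  by rewrite -{1}(ger0_norm s0) -normrM E normrN normrM (ger0_norm h0).
have := normr_ge0 (y - x); nra.
Qed.

Definition quad_m (R : realType) (lam x : R) : R := x - coef_b lam / coef_a lam.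
Definition quad_n (R : realType) (lam x : R) : R :=
  coef_d lam / (coef_a lam * x).

(** Dividing the cubic by y - x leaves a (y^2 + m y + n), and a root off the
    real axis annihilates this quadratic. *)
Lemma upper_rootE (R : realType) (lam x u v : R) :
  coef_a lam != 0 -> x != 0 -> root (cubic (dilate lam)) x -> 0 < v ->
  root (map_poly (real_complex R) (cubic (dilate lam))) (Complex u v) =
  (u == - quad_m lam x / 2) && (u ^+ 2 + v ^+ 2 == quad_n lam x).
Proof.
move=> a0 x0; rewrite !rootE horner_cubic horner_cubicC /cubic_val => /eqP.
rewrite /quad_m /quad_n.
move: a0; set a := coef_a lam; set b := coef_b lam; set c := coef_c lam.
set d := coef_d lam => a0 Ex v0.
pose re := a * (u ^+ 3 - 3 * u * v ^+ 2) - b * (u ^+ 2 - v ^+ 2) - c * u - d.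
pose im := v * (a * (3 * u ^+ 2 - v ^+ 2) - 2 * b * u - c).
have -> : real_complex R a * Complex u v ^+ 3
    - real_complex R b * Complex u v ^+ 2
    - real_complex R c * Complex u v - real_complex R d = Complex re im.
  apply/eqP; rewrite eq_complex !exprS expr0 /=.
  by apply/andP; split; apply/eqP; rewrite /re /im; ring.
rewrite eq_complex /=.
(* re + i im = (z - x) (q1 + i v q2), with q1 + i v q2 the value at z of the
   quotient of the cubic by y - x. *)
pose q1 := a * (u ^+ 2 - v ^+ 2) + (a * x - b) * u + (a * x ^+ 2 - b * x - c).
pose q2 := 2 * a * u + a * x - b.
have reE : re = (u - x) * q1 - v ^+ 2 * q2.
  rewrite -[LHS]subr0 -[X in _ - X]Ex /re /q1 /q2; ring.
have imE : im = v * ((u - x) * q2 + q1) by rewrite /im /q1 /q2; ring.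
have ux : (u - x) ^+ 2 + v ^+ 2 != 0.
  by rewrite gt_eqF// ltr_wpDl ?sqr_ge0 ?exprn_gt0.
have dE : d = x * (a * x ^+ 2 - b * x - c) by rewrite -[LHS]addr0 -Ex; ring.
have uE : (u == - (x - b / a) / 2) = (q2 == 0).
  rewrite -subr_eq0 (_ : u - _ = q2 / (2 * a)); last by rewrite /q2; field.
  by rewrite mulf_eq0 invr_eq0 mulf_eq0 (negbTE a0) orbF pnatr_eq0 orbF.
rewrite uE; apply/andP/andP.
  move=> [/eqP re0 /eqP im0].
  have im0' : (u - x) * q2 + q1 = 0.
    by move/eqP: im0; rewrite imE mulf_eq0 gt_eqF//= => /eqP.
  have q20 : q2 = 0.
    have : ((u - x) ^+ 2 + v ^+ 2) * q2 = 0.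
      have -> : ((u - x) ^+ 2 + v ^+ 2) * q2 =
        (u - x) * ((u - x) * q2 + q1) - ((u - x) * q1 - v ^+ 2 * q2) by ring.
      by rewrite im0' -reE re0 mulr0 subrr.
    by move/eqP; rewrite mulf_eq0 (negbTE ux) => /eqP.
  rewrite q20 eqxx; split => //; apply/eqP.
  move: im0'; rewrite q20 mulr0 add0r => q10.
  rewrite dE (_ : _ - c = a * (u ^+ 2 + v ^+ 2) + q1 - u * q2); last first.
    by rewrite /q1 /q2; ring.
  by rewrite q10 q20; field; apply/andP.
move=> [/eqP q20 /eqP N].
have q10 : q1 = 0.
  have : a * (u ^+ 2 + v ^+ 2) = a * x ^+ 2 - b * x - c.
    by rewrite N dE; field; apply/andP.
  move=> N'; rewrite (_ : q1 = u * q2 + (a * x ^+ 2 - b * x - c)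
                             - a * (u ^+ 2 + v ^+ 2)).
    by rewrite q20 N'; ring.
  by rewrite /q1 /q2; ring.
by rewrite reE imE q10 q20 !mulr0 subrr addr0 mulr0 eqxx.
Qed.

(** * The logarithmic potential at the roots *)

Lemma ln_sqrt (R : realType) (x : R) : ln (Num.sqrt x) = ln x / 2.
Proof.
case: (ltP 0 x) => x0; last by rewrite ler0_sqrtr// !ln0// mul0r.
have s0 : 0 < Num.sqrt x by rewrite sqrtr_gt0.
by rewrite -{2}(sqr_sqrtr (ltW x0)) lnXn//; lra.
Qed.

Lemma ln_normc (R : realType) (u v : R) :
  ln (ComplexField.Normc.normc (Complex u v)) = ln (u ^+ 2 + v ^+ 2) / 2.
Proof. exact: ln_sqrt. Qed.

Lemma F_real (R : realType) (p : R * R) (x : R) : 25 < x ->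
  F p (real_complex R x) =
  p.1 * ln x + p.2 * ln (x ^+ 2 + 6 * x + 25) - ln (x - 25).
Proof.
move=> x25; have x2 : 0 <= x ^+ 2 by rewrite sqr_ge0.
have normcR (y : R) : ComplexField.Normc.normc (real_complex R y) = `|y|.
  by rewrite /= expr0n addr0 sqrtr_sqr.
rewrite /F.
have -> : real_complex R x ^+ 2 + 6 * real_complex R x + 25 =
    real_complex R (x ^+ 2 + 6 * x + 25).
  by rewrite !rmorphD rmorphXn rmorphM !rmorph_nat.
have -> : 25 - real_complex R x = real_complex R (25 - x).
  by rewrite rmorphB rmorph_nat.
rewrite !normcR distrC !gtr0_norm//; lra.
Qed.

(** |z^2 + 6 z + 25|^2 for a non-real root z of z^2 + m z + n. *)
Definition quad_norm (R : pzRingType) (m n : R) : R :=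
  n ^+ 2 - 6 * n * m - 14 * n + 25 * m ^+ 2 - 150 * m + 625.

(** The hypotheses say that u + i v is a root of z^2 + m z + n, and the squared
    moduli of z, z^2 + 6 z + 25 and 25 - z are polynomials in m and n. *)
Lemma F_complex (R : realType) (p : R * R) (m n u v : R) :
  u = - m / 2 -> u ^+ 2 + v ^+ 2 = n ->
  F p (Complex u v) =
  (p.1 * ln n + p.2 * ln (quad_norm m n) - ln (625 + 25 * m + n)) / 2.
Proof.
move=> um nE; rewrite /F ln_normc nE.
have natC (k : nat) : k%:R = Complex k%:R 0 :> R[i].
  by rewrite -(rmorph_nat (real_complex R)).
have -> : Complex u v ^+ 2 + 6 * Complex u v + 25 =
    Complex (u ^+ 2 - v ^+ 2 + 6 * u + 25) (2 * u * v + 6 * v).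
  apply/eqP; rewrite !natC eq_complex exprS expr1 /=.
  by apply/andP; split; apply/eqP; ring.
have -> : 25 - Complex u v = Complex (25 - u) (- v).
  apply/eqP; rewrite !natC eq_complex /=.
  by apply/andP; split; apply/eqP; ring.
rewrite !ln_normc.
have -> : (u ^+ 2 - v ^+ 2 + 6 * u + 25) ^+ 2 + (2 * u * v + 6 * v) ^+ 2 =
    quad_norm m n.
  have -> : m = - 2 * u by rewrite um; field.
  by rewrite /quad_norm -nE; ring.
have -> : (25 - u) ^+ 2 + (- v) ^+ 2 = 625 + 25 * m + n.
  have -> : m = - 2 * u by rewrite um; field.
  by rewrite -nE; ring.
by field.
Qed.

Lemma upper_roots_nonempty (R : realType) (lam x : R) :
  coef_a lam != 0 -> x != 0 -> root (cubic (dilate lam)) x ->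
  quad_m lam x ^+ 2 / 4 < quad_n lam x -> upper_roots (dilate lam) !=set0.
Proof.
move=> a0 x0 rx disc.
pose v := Num.sqrt (quad_n lam x - quad_m lam x ^+ 2 / 4).
have v0 : 0 < v by rewrite sqrtr_gt0 subr_gt0.
exists (Complex (- quad_m lam x / 2) v); split => //.
rewrite (upper_rootE (x := x))// eqxx /= sqr_sqrtr; last first.
  by rewrite subr_ge0 ltW.
by apply/eqP; field.
Qed.

Lemma s_dilate (R : realType) (lam x : R) :
  coef_a lam != 0 -> x != 0 -> root (cubic (dilate lam)) x ->
  upper_roots (dilate lam) !=set0 ->
  let m := quad_m lam x in let n := quad_n lam x in
  s (dilate lam) = (lam / 3 * ln n + 2 * lam / 3 * ln (quad_norm m n)
                    - ln (625 + 25 * m + n)) / 2.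
Proof.
move=> a0 x0 rx [z0 uz0] m n; rewrite /s.
have [] : upper_roots (dilate lam) (y_c (dilate lam)) by exact: xgetI uz0.
case: (y_c _) => u v /= v0; rewrite (upper_rootE (x := x))//.
by move=> /andP[/eqP uE /eqP nE]; exact: F_complex.
Qed.

(** * Functions that are Lipschitz at 0 from the right *)

Definition lip0 (R : realType) (f : R -> R) : Prop :=
  exists L : R, \forall h \near 0^'+, `|f h - f 0| <= L * h.

Lemma lip0_le (R : realType) (f : R -> R) : lip0 f ->
  exists2 L : R, 0 <= L & \forall h \near 0^'+, `|f h - f 0| <= L * h.
Proof.
move=> [L fL]; exists `|L| => //; near=> h.
have h0 : 0 < h by near: h; exact: nbhs_right_gt.
have : `|f h - f 0| <= L * h by near: h.
by move/le_trans; apply; rewrite ler_pM2r// ler_norm.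
Unshelve. all: end_near. Qed.

Lemma lip0_eq (R : realType) (f g : R -> R) :
  (\forall h \near 0^'+, f h = g h) -> f 0 = g 0 -> lip0 g -> lip0 f.
Proof.
move=> fg fg0 [L gL]; exists L; near=> h.
by rewrite fg0 (_ : f h = g h); near: h.
Unshelve. all: end_near. Qed.

Lemma lip0_cst (R : realType) (c : R) : lip0 (fun=> c).
Proof. by exists 0; apply: nearW => h; rewrite subrr normr0 mul0r. Qed.

Lemma lip0_id (R : realType) : lip0 (fun h : R => h).
Proof.
by exists 1; near=> h; rewrite subr0 mul1r gtr0_norm.
Unshelve. all: end_near. Qed.

Lemma lip0D (R : realType) (f g : R -> R) :
  lip0 f -> lip0 g -> lip0 (fun h => f h + g h).
Proof.
move=> [L fL] [M gM]; exists (L + M); near=> h.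
have : `|f h - f 0| <= L * h by near: h.
have : `|g h - g 0| <= M * h by near: h.
rewrite (_ : f h + g h - _ = (f h - f 0) + (g h - g 0)); last by ring.
have := ler_normD (f h - f 0) (g h - g 0); lra.
Unshelve. all: end_near. Qed.

Lemma lip0M (R : realType) (f g : R -> R) :
  lip0 f -> lip0 g -> lip0 (fun h => f h * g h).
Proof.
move=> /lip0_le[L L0 fL] /lip0_le[M M0 gM].
exists (L * M + `|f 0| * M + L * `|g 0|); near=> h.
have h0 : 0 < h by near: h; exact: nbhs_right_gt.
have h1 : h < 1 by near: h; exact: nbhs_right_lt.
have fh : `|f h - f 0| <= L * h by near: h.
have gh : `|g h - g 0| <= M * h by near: h.
rewrite (_ : f h * g h - _ = (f h - f 0) * (g h - g 0) + f 0 * (g h - g 0)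
                            + (f h - f 0) * g 0); last by ring.
apply: le_trans (ler_normD _ _) _; rewrite [leRHS]mulrDl.
apply: lerD; last by rewrite normrM mulrAC ler_wpM2r.
apply: le_trans (ler_normD _ _) _; rewrite [leRHS]mulrDl !normrM.
apply: lerD; last by rewrite -mulrA ler_wpM2l.
apply: (@le_trans _ _ ((L * h) * (M * h))); first exact: ler_pM.
have : 0 <= L * M * h by rewrite !mulr_ge0// ltW.
by nra.
Unshelve. all: end_near. Qed.

Lemma lip0N (R : realType) (f : R -> R) : lip0 f -> lip0 (fun h => - f h).
Proof.
move=> [L fL]; exists L; near=> h.
by rewrite -opprD normrN; near: h.
Unshelve. all: end_near. Qed.

Lemma lip0B (R : realType) (f g : R -> R) :
  lip0 f -> lip0 g -> lip0 (fun h => f h - g h).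
Proof. by move=> lf /lip0N; exact: lip0D. Qed.

Lemma lip0_gt_half (R : realType) (f : R -> R) : lip0 f -> 0 < f 0 ->
  \forall h \near 0^'+, f 0 / 2 < f h.
Proof.
move=> /lip0_le[L L0 fL] f0; near=> h.
have h0 : 0 < h by near: h; exact: nbhs_right_gt.
have hf : h < f 0 / 2 / (L + 1).
  by near: h; apply: nbhs_right_lt; rewrite !divr_gt0//; lra.
have : `|f h - f 0| <= L * h by near: h.
rewrite ler_norml => /andP[fh _].
by move: hf; rewrite ltr_pdivlMr; nra.
Unshelve. all: end_near. Qed.

Lemma lip0V (R : realType) (f : R -> R) : lip0 f -> 0 < f 0 ->
  lip0 (fun h => (f h)^-1).
Proof.
move=> lf f0; have half := lip0_gt_half lf f0; case: lf => L fL.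
exists (L * (2 / f 0 ^+ 2)); near=> h.
have fh : `|f h - f 0| <= L * h by near: h.
have f2 : f 0 / 2 < f h by near: h.
have fh0 : 0 < f h by lra.
have -> : (f h)^-1 - (f 0)^-1 = - ((f h - f 0) * (f h * f 0)^-1).
  by field; rewrite !gt_eqF.
rewrite normrN normrM mulrAC; apply: ler_pM => //.
rewrite gtr0_norm ?invr_gt0 ?mulr_gt0// -[leRHS]invf_div.
rewrite lef_pV2 ?posrE ?divr_gt0 ?exprn_gt0 ?mulr_gt0// expr2.
by rewrite mulrAC ler_pM2r// ltW.
Unshelve. all: end_near. Qed.

Lemma ln_sub_le (R : realType) (u v : R) : 0 < u -> 0 < v ->
  ln u - ln v <= (u - v) / v.
Proof.
move=> u0 v0; rewrite -ln_div ?posrE//.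
have -> : (u - v) / v = u / v - 1 by field; rewrite gt_eqF.
have := @le_ln1Dx R (u / v - 1); rewrite [1 + _]addrC subrK; apply.
by have : 0 < u / v by [rewrite divr_gt0]; lra.
Qed.

Lemma lip0_ln (R : realType) (f : R -> R) : lip0 f -> 0 < f 0 ->
  lip0 (fun h => ln (f h)).
Proof.
move=> lf f0; have half := lip0_gt_half lf f0; case: lf => L fL.
exists (L * (2 / f 0)); near=> h.
have fh : `|f h - f 0| <= L * h by near: h.
have f2 : f 0 / 2 < f h by near: h.
have fh0 : 0 < f h by lra.
have inv_le (w : R) : f 0 / 2 <= w -> w^-1 <= 2 / f 0.
  move=> w2; rewrite -[leRHS]invf_div lef_pV2 ?posrE ?divr_gt0//.
  by apply: lt_le_trans w2; rewrite divr_gt0.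
have bound (w d : R) : f 0 / 2 <= w -> `|d| <= L * h ->
    d / w <= L * (2 / f 0) * h.
  move=> w2 dL; have w0 : 0 < w by lra.
  apply: le_trans (ler_norm _) _; rewrite normrM mulrAC.
  by apply: ler_pM => //; rewrite gtr0_norm ?invr_gt0// inv_le.
rewrite ler_norml lerNl opprB; apply/andP; split.
  apply: le_trans (ln_sub_le f0 fh0) _.
  by apply: bound; [exact: ltW|rewrite distrC].
apply: le_trans (ln_sub_le fh0 f0) _.
by apply: bound => //; lra.
Unshelve. all: end_near. Qed.

Lemma lip0_sqr (R : realType) (f : R -> R) :
  lip0 f -> lip0 (fun h => f h ^+ 2).
Proof. by move=> lf; exact: (lip0M lf lf). Qed.

(* Matching on the head symbol keeps unification from unfolding the terms. *)
Ltac lip0_tac :=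
  lazymatch goal with
  | |- lip0 (fun _ => ?c) => exact: lip0_cst
  | |- lip0 (fun h => h) => exact: lip0_id
  | |- lip0 (fun h => Algebra.add (@?f h) (Algebra.opp (@?g h))) =>
      refine (@lip0B _ f g _ _); lip0_tac
  | |- lip0 (fun h => Algebra.add (@?f h) (@?g h)) =>
      refine (@lip0D _ f g _ _); lip0_tac
  | |- lip0 (fun h => GRing.mul (@?f h) (@?g h)) =>
      refine (@lip0M _ f g _ _); lip0_tac
  | |- lip0 (fun h => GRing.exp (@?f h) 2) =>
      refine (@lip0_sqr _ f _); lip0_tac
  | |- _ => try assumption
  end.

(** * The values r and s along the ray *)

Lemma y_plus_lip0 (R : realType) : lip0 (fun h : R => y_plus (dilate (1 + h))).
Proof.
exists 400; near=> h; apply: y_plus_lip; apply/andP; split.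
  by apply: ltW; near: h; exact: nbhs_right_gt.
by apply: ltW; near: h; apply: nbhs_right_lt; lra.
Unshelve. all: end_near. Qed.

Lemma near_y_plusP (R : realType) :
  \forall h \near (0 : R)^'+, 60 < y_plus (dilate (1 + h)) < 67 /\
    root (cubic (dilate (1 + h))) (y_plus (dilate (1 + h))).
Proof.
near=> h; apply: y_plusP; apply/andP; split.
  by apply: ltW; near: h; exact: nbhs_right_gt.
by apply: ltW; near: h; apply: nbhs_right_lt; lra.
Unshelve. all: end_near. Qed.

Lemma coef_a_gt0 (R : realType) (h : R) : 0 <= h -> 0 < coef_a (1 + h).
Proof. by rewrite /coef_a; lra. Qed.

Definition ray_m (R : realType) (h : R) : R :=
  quad_m (1 + h) (y_plus (dilate (1 + h))).
Definition ray_n (R : realType) (h : R) : R :=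
  quad_n (1 + h) (y_plus (dilate (1 + h))).

Lemma lip0_coef_a (R : realType) : lip0 (fun h : R => coef_a (1 + h)).
Proof. by rewrite /coef_a; lip0_tac. Qed.

Lemma lip0_ray_m (R : realType) : lip0 (@ray_m R).
Proof.
apply: lip0B; first exact: y_plus_lip0.
apply: lip0M; first by rewrite /coef_b; lip0_tac.
by apply: lip0V; [exact: lip0_coef_a|exact: coef_a_gt0].
Qed.

Lemma lip0_ray_n (R : realType) : lip0 (@ray_n R).
Proof.
apply: lip0M; first by rewrite /coef_d; lip0_tac.
apply: lip0V; first by apply: lip0M; [exact: lip0_coef_a|exact: y_plus_lip0].
by rewrite mulr_gt0 ?coef_a_gt0//; have := y_plus_base R; lra.
Qed.

(** At the base point m = x - 125/2 and n = 625 / (2 x), with x the positive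
    root. *)
Lemma ray_base (R : realType) :
  7 / 2 < ray_m (0 : R) < 4 /\ 23 / 5 < ray_n (0 : R) < 5.
Proof.
rewrite /ray_m /ray_n /quad_m /quad_n; have := y_plus_base R.
move: (y_plus _) => x xb.
have -> : coef_a (1 + 0) = 2 / 3 :> R by rewrite /coef_a; lra.
have -> : coef_b (1 + 0) / (2 / 3) = 125 / 2 :> R by rewrite /coef_b; field.
have -> : coef_d (1 + 0) / (2 / 3 * x) = 625 / 2 / x.
  by rewrite /coef_d; field; apply/eqP; lra.
split; first lra.
by rewrite ltr_pdivlMr ?ltr_pdivrMr; lra.
Qed.

Lemma quad_norm_base (R : realType) (m n : R) :
  7 / 2 < m < 4 -> 23 / 5 < n < 5 -> 200 < quad_norm m n < 300.
Proof. by rewrite /quad_norm => mb nb; apply/andP; split; nra. Qed.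

Lemma disc_base (R : realType) : ray_m (0 : R) ^+ 2 / 4 < ray_n 0.
Proof. by have [] := ray_base R; nra. Qed.

Lemma upper_roots_base (R : realType) : upper_roots (dilate (1 + 0 : R)) !=set0.
Proof.
have [xb rx] : _ := @y_plusP R 0 ltac:(lra).
apply: upper_roots_nonempty rx (disc_base R).
  by rewrite gt_eqF ?coef_a_gt0.
by apply/eqP; lra.
Qed.

Lemma near_upper_roots (R : realType) :
  \forall h \near (0 : R)^'+, upper_roots (dilate (1 + h)) !=set0.
Proof.
have ldisc : lip0 (fun h : R => ray_n h - ray_m h ^+ 2 / 4).
  apply: lip0B; first exact: lip0_ray_n.
  apply: lip0M; last exact: lip0_cst.
  apply: lip0_sqr; exact: lip0_ray_m.
have disc0 : 0 < ray_n (0 : R) - ray_m 0 ^+ 2 / 4.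
  by rewrite subr_gt0; exact: disc_base.
have disc := lip0_gt_half ldisc disc0.
near=> h.
have h0 : 0 < h by near: h; exact: nbhs_right_gt.
have [xb rx] : 60 < y_plus (dilate (1 + h)) < 67 /\
    root (cubic (dilate (1 + h))) (y_plus (dilate (1 + h))).
  by near: h; exact: near_y_plusP.
apply: upper_roots_nonempty rx _.
- by rewrite gt_eqF// coef_a_gt0// ltW.
- by apply/eqP; lra.
- rewrite -/(ray_m h) -/(ray_n h) -subr_gt0.
  have : (ray_n 0 - ray_m 0 ^+ 2 / 4) / 2 < ray_n h - ray_m h ^+ 2 / 4.
    by near: h.
  by apply: le_lt_trans; rewrite divr_ge0// ltW.
Unshelve. all: end_near. Qed.

Definition ray_s (R : realType) (h : R) : R :=
  ((1 + h) / 3 * ln (ray_n h)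
   + 2 * (1 + h) / 3 * ln (quad_norm (ray_m h) (ray_n h))
   - ln (625 + 25 * ray_m h + ray_n h)) / 2.

Lemma ray_sE (R : realType) (h : R) : 0 <= h ->
  60 < y_plus (dilate (1 + h)) < 67 /\
    root (cubic (dilate (1 + h))) (y_plus (dilate (1 + h))) ->
  upper_roots (dilate (1 + h)) !=set0 -> s (dilate (1 + h)) = ray_s h.
Proof.
move=> h0 [xb rx] ur; apply: s_dilate ur => //.
  by rewrite gt_eqF ?coef_a_gt0.
by apply/eqP; lra.
Qed.

Lemma s_base (R : realType) : s (dilate (1 + 0 : R)) = ray_s 0.
Proof.
apply: ray_sE => //; last exact: upper_roots_base.
by apply: y_plusP; lra.
Qed.

Lemma s_lip0 (R : realType) : lip0 (fun h : R => s (dilate (1 + h))).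
Proof.
have [mb nb] := ray_base R.
have qb := quad_norm_base mb nb.
have lm := @lip0_ray_m R; have ln_ := @lip0_ray_n R.
apply: (@lip0_eq _ _ (@ray_s R)); last 1 first.
- apply: lip0M; last exact: lip0_cst.
  apply: lip0B; first apply: lip0D.
  + apply: lip0M; first by lip0_tac.
    by apply: lip0_ln => //; lra.
  + apply: lip0M; first by lip0_tac.
    apply: lip0_ln; last by lra.
    by rewrite /quad_norm; lip0_tac.
  + by apply: lip0_ln; [lip0_tac|lra].
- near=> h; apply: ray_sE.
  + by apply: ltW; near: h; exact: nbhs_right_gt.
  + by near: h; exact: near_y_plusP.
  + by near: h; exact: near_upper_roots.
- exact: s_base.
Unshelve. all: end_near. Qed.

Lemma r_dilate (R : realType) (lam : R) : 25 < y_plus (dilate lam) ->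
  let x := y_plus (dilate lam) in
  r (dilate lam) =
  lam / 3 * ln x + 2 * lam / 3 * ln (x ^+ 2 + 6 * x + 25) - ln (x - 25).
Proof. by move=> x25 x; rewrite /r F_real. Qed.

Lemma r_lip0 (R : realType) : lip0 (fun h : R => r (dilate (1 + h))).
Proof.
have xb := y_plus_base R; have lx := @y_plus_lip0 R.
pose x (h : R) := y_plus (dilate (1 + h)).
apply: (@lip0_eq _ _ (fun h => (1 + h) / 3 * ln (x h) +
  2 * (1 + h) / 3 * ln (x h ^+ 2 + 6 * x h + 25) - ln (x h - 25))).
- near=> h; apply: r_dilate.
  have [] : 60 < y_plus (dilate (1 + h)) < 67 /\
      root (cubic (dilate (1 + h))) (y_plus (dilate (1 + h))).
    by near: h; exact: near_y_plusP.
  by lra.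
- by apply: r_dilate; lra.
- apply: lip0B; first apply: lip0D.
  + apply: lip0M; first by lip0_tac.
    by apply: lip0_ln => //; rewrite /x; lra.
  + apply: lip0M; first by lip0_tac.
    apply: lip0_ln; last by rewrite /x; nra.
    by lip0_tac.
  + by apply: lip0_ln; [lip0_tac|rewrite /x; lra].
Unshelve. all: end_near. Qed.

Lemma r_base_ge0 (R : realType) : 0 <= r (dilate (1 + 0 : R)).
Proof.
have xb := y_plus_base R; rewrite r_dilate; last by lra.
move: xb; move: (y_plus _) => x xb.
have l1 : 0 <= ln x by apply: ln_ge0; lra.
have l2 : 0 <= ln (x - 25) by apply: ln_ge0; lra.
have : ln ((x - 25) ^+ 2) <= ln (x ^+ 2 + 6 * x + 25).
  by rewrite ler_ln ?posrE; nra.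
by rewrite lnXn; lra.
Qed.

(** The lower bound comes from 2 = 3/2 * 4/3 and - ln (1 - x) >= x. *)
Lemma ln2_bounds (R : realType) : 7 / 12 <= (ln 2 : R) <= 1.
Proof.
apply/andP; split; last by have := @le_ln1Dx R 1; apply; lra.
have -> : 2 = (1 + - (1 / 3))^-1 * (1 + - (1 / 4))^-1 :> R by field.
rewrite lnM ?posrE ?invr_gt0; [|lra|lra]; rewrite !lnV ?posrE; [|lra|lra].
have := @le_ln1Dx R (- (1 / 3)); have := @le_ln1Dx R (- (1 / 4)); lra.
Qed.

Lemma G_base (R : realType) :
  G (dilate (1 + 0 : R)) = 4 / 3 - 5 / 6 * ln 2.
Proof. by rewrite /G /dilate /=; lra. Qed.

(** Taking logarithms in |25 - y_c|^6 >= 2^9 |y_c|^2 |y_c^2 + 6 y_c + 25|^4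
    gives - 6 s >= 9 ln 2, while 6 G = 8 - 5 ln 2 and 14 ln 2 > 8. *)
Lemma s_base_lt (R : realType) :
  s (dilate (1 + 0 : R)) < - G (dilate (1 + 0)).
Proof.
rewrite s_base G_base /ray_s; have [mb nb] := ray_base R.
have qb := quad_norm_base mb nb.
move: (quad_norm _ _) qb => q qb; move: (ray_m 0) mb => m mb.
move: (ray_n 0) nb => n nb.
have : ln (2 ^+ 9 * (n * q ^+ 2)) <= ln ((625 + 25 * m + n) ^+ 3).
  have : 700 < 625 + 25 * m + n by lra.
  move: (625 + 25 * m + n) => D Db.
  have q2 : q ^+ 2 <= 9 / 49 * D ^+ 2.
    have -> : 9 / 49 * D ^+ 2 = (3 / 7 * D) ^+ 2 by field.
    by apply: lerXn2r; rewrite ?nnegrE; lra.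
  have q0 : 0 < q ^+ 2 by rewrite exprn_gt0; lra.
  have nq : n * q ^+ 2 <= 5 * q ^+ 2 by rewrite ler_pM2r; lra.
  have D3 : 700 * D ^+ 2 <= D ^+ 3.
    by rewrite [leRHS]exprS ler_pM2r ?exprn_gt0; lra.
  rewrite ler_ln ?posrE; [lra| |by rewrite exprn_gt0; lra].
  by rewrite !mulr_gt0 ?exprn_gt0; lra.
have q0 : 0 < q by lra.
have n0 : 0 < n by lra.
rewrite lnM ?posrE ?mulr_gt0 ?exprn_gt0// lnM ?posrE ?exprn_gt0//.
by rewrite !lnXn; have := ln2_bounds R; lra.
Qed.

Lemma G_lip0 (R : realType) : lip0 (fun h : R => G (dilate (1 + h))).
Proof. by rewrite /G /dilate /=; lip0_tac. Qed.

(** * Comparison of the ratios *)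

(** After cross-multiplication a drop of c counts with weight r0 - s0, the sum
    of the numerator and the denominator. *)
Lemma ratio_lt (R : realType) (r0 s0 c0 r1 s1 c1 : R) :
  0 < - s0 - c0 -> 0 < - s1 - c1 ->
  (r1 - r0) * (- s0 - c0) + (s1 - s0) * (r0 + c0) < (c0 - c1) * (r0 - s0) ->
  1 + (r1 + c1) / (- s1 - c1) < 1 + (r0 + c0) / (- s0 - c0).
Proof.
move=> d0 d1 lt; rewrite ltrD2l ltr_pdivrMr// mulrAC ltr_pdivlMr//.
by move: lt; lra.
Qed.

Lemma calB_defined_base (R : realType) : calB_defined (dilate (1 + 0 : R)).
Proof.
split; last 1 first.
- rewrite subr_gt0; have := s_base_lt R; have := phi_ge0 (dilate (1 + 0 : R)).
  by rewrite /calC; lra.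
- by rewrite /dilate; split => /=; lra.
- exact: upper_roots_base.
Qed.

Lemma calB_dilate_lt (R : realType) : \forall h \near (0 : R)^'+,
  calB_defined (dilate (1 + h)) /\
  calB (dilate (1 + h)) < calB (dilate (1 + 0)).
Proof.
have [_ _] := calB_defined_base R.
have r0_ge0 := r_base_ge0 R.
have s0_lt : s (dilate (1 + 0 : R)) < 0.
  apply: lt_trans (s_base_lt R) _; rewrite G_base.
  by have := ln2_bounds R; lra.
have [Lr Lr0 near_r] := lip0_le (@r_lip0 R).
have [Ls Ls0 near_s] := lip0_le (@s_lip0 R).
have [Lg Lg0 near_g] := lip0_le (@G_lip0 R).
rewrite /calB.
move: near_r near_s near_g r0_ge0 s0_lt.
set r0 := r (dilate (1 + 0)); set s0 := s (dilate (1 + 0)).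
set c0 := calC (dilate (1 + 0)) => near_r near_s near_g r0_ge0 s0_lt d0.
pose M := Lr * (- s0 - c0) + Ls * `|r0 + c0|.
have M0 : 0 <= M by rewrite addr_ge0// mulr_ge0// ltW.
have gap : 0 < r0 - s0 by lra.
(* phi pays for the linear growth of G, for keeping the denominator positive
   and for the increments of r and s, collected in M. *)
have [h0 h0_gt0 steep] := phi_dilate_steep (Lg + Ls + 1 + M / (r0 - s0)).
near=> h.
have h_gt0 : 0 < h by near: h; exact: nbhs_right_gt.
have rh : `|r (dilate (1 + h)) - r0| <= Lr * h by near: h.
have sh : `|s (dilate (1 + h)) - s0| <= Ls * h by near: h.
have gh : `|G (dilate (1 + h)) - G (dilate (1 + 0))| <= Lg * h by near: h.
have ur : upper_roots (dilate (1 + h)) !=set0.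
  by near: h; exact: near_upper_roots.
have drop : (Ls + 1 + M / (r0 - s0)) * h <= c0 - calC (dilate (1 + h)).
  have /steep : 0 < h < h0.
    by rewrite h_gt0 /=; near: h; exact: nbhs_right_lt.
  move: gh; rewrite ler_norml /c0 /calC addr0 => /andP[_ gh].
  by lra.
have Mh : 0 <= M / (r0 - s0) * h by rewrite !mulr_ge0 ?invr_ge0// ltW.
have d1 : 0 < - s (dilate (1 + h)) - calC (dilate (1 + h)).
  by move: sh; rewrite ler_norml => /andP[_ sh]; lra.
split; first by split => //; rewrite /dilate; split => /=; lra.
apply: ratio_lt => //.
have step_r : (r (dilate (1 + h)) - r0) * (- s0 - c0) <= Lr * h * (- s0 - c0).
  by rewrite ler_pM2r//; apply: le_trans rh; exact: ler_norm.
have step_s : (s (dilate (1 + h)) - s0) * (r0 + c0) <= Ls * h * `|r0 + c0|.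
  by apply: le_trans (ler_norm _) _; rewrite normrM ler_wpM2r.
have := ler_wpM2r (ltW gap) drop.
have -> : (Ls + 1 + M / (r0 - s0)) * h * (r0 - s0) =
    (Ls + 1) * h * (r0 - s0) + M * h by field; rewrite gt_eqF.
have : 0 < (Ls + 1) * h * (r0 - s0) by rewrite !mulr_gt0//; lra.
by rewrite /M; lra.
Unshelve. all: end_near. Qed.

Theorem mainTheorem3 (R : realType) :
  let p0 : R * R := (1 / 3, 2 / 3) in
  let p (e : R) : R * R := (1 / 3 + e * (1 / 2), 2 / 3 + e * 1) in
  calB_defined p0 /\
  exists2 e0 : R, 0 < e0 &
    forall e : R, 0 < e < e0 -> calB_defined (p e) /\ calB (p e) < calB p0.
Proof.
move=> p0 p.
have pE e : p e = dilate (1 + 3 / 2 * e) by congr (_, _); lra.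
have p0E : p0 = dilate (1 + 0) by congr (_, _); lra.
rewrite p0E; split; first exact: calB_defined_base.
have [h0 /= h0_gt0 lt_h0] := calB_dilate_lt R.
exists (2 / 3 * h0); first by lra.
move=> e /andP[e_gt0 e_lt]; rewrite pE; apply: lt_h0; last by lra.
by rewrite /ball_ /= sub0r normrN gtr0_norm; lra.
Qed.
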